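(* For each complete atomic boolean algebra $B$, the frame $\mathcal{NO}(B)$ of necessity operators on $B$ is locally Stone. However, $\mathcal{NO}(\wp(\mathbb{N}))$ is not a coframe, not completely distributive, and not a boolean algebra, where $\wp(\mathbb{N})$ is the powerset algebra of $\mathbb{N}$.
   Context: A necessity operator on a boolean algebra $B$ is a function $\Box\colon B\to B$ preserving finite meets (including the empty meet, so $\Box 1=1$). $\mathcal{NO}(B)$ is the set of necessity operators on $B$, ordered pointwise: $f\le g$ iff $f(a)\le g(a)$ for all $a\in B$. It is a frame when $B$ is complete. A frame is a complete lattice $L$ satisfying $a\wedge\bigvee S=\bigvee\{a\wedge b\mid b\in S\}$ for all $a\in L$, $S\subseteq L$; a coframe is a complete lattice satisfying the order-dual law $a\vee\bigwedge S=\bigwedge\{a\vee b\mid b\in S\}$. A frame is zero-dimensional if each of its elements is a join of complemented elements, and algebraic if each of its elements is a join of compact elements. A locally Stone frame is a frame that is zero-dimensional and algebraic. *)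

(* Defs.v *)
From HB Require Import structures.
From mathcomp Require Import all_boot all_order.
From mathcomp Require Import boolp classical_sets functions cardinality.

Set Implicit Arguments.
Unset Strict Implicit.
Unset Printing Implicit Defensive.

Import Order.TTheory.

Local Open Scope order_scope.
Local Open Scope classical_set_scope.

(* Order-theoretic notions on a partial order [L].  Meets and joins are
   relational: [supremums S x] and [infimums S x] say that [x] is the (unique)
   join, resp. meet, of [S].  In particular [supremums set0 x] says that [x] is
   the least element, and [infimums set0 x] that it is the greatest one. *)
Section OrderNotions.
Context {d : Order.disp_t}.
Implicit Type L : porderType d.

Definition complete_lattice L : Prop :=
  forall S : set L, (supremums S !=set0) /\ (infimums S !=set0).

(* {a /\ b | b in S} and {a \/ b | b in S} *)
Definition meets_with L (a : L) (S : set L) : set L :=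
  [set c | exists2 b, S b & infimums [set a; b] c].

Definition joins_with L (a : L) (S : set L) : set L :=
  [set c | exists2 b, S b & supremums [set a; b] c].

Definition frame L : Prop :=
  complete_lattice L /\
  forall (a : L) (S : set L) (s m : L),
    supremums S s -> infimums [set a; s] m -> supremums (meets_with a S) m.

Definition coframe L : Prop :=
  complete_lattice L /\
  forall (a : L) (S : set L) (s m : L),
    infimums S s -> supremums [set a; s] m -> infimums (joins_with a S) m.

Definition completely_distributive L : Prop :=
  complete_lattice L /\
  forall (I : Type) (J : I -> Type) (x : forall i, J i -> L) (s : I -> L)
    (m : L),
    (forall i, supremums (range (x i)) (s i)) -> infimums (range s) m ->
    supremums [set c | exists f : forall i, J i,
                         infimums (range (fun i => x i (f i))) c] m.

Definition complement L (x y : L) : Prop :=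
  (infimums [set x; y] `&` supremums set0 !=set0) /\
  (supremums [set x; y] `&` infimums set0 !=set0).

Definition complemented L (x : L) : Prop := exists y : L, complement x y.

Definition compact_element L (k : L) : Prop :=
  forall (S : set L) (s : L), supremums S s -> k <= s ->
  exists (F : set L) (t : L),
    [/\ finite_set F, F `<=` S, supremums F t & k <= t].

Definition zero_dimensional L : Prop :=
  forall x : L, exists2 S : set L, S `<=` complemented (L := L) & supremums S x.

Definition algebraic L : Prop :=
  forall x : L,
  exists2 S : set L, S `<=` compact_element (L := L) & supremums S x.

Definition locally_stone_frame L : Prop :=
  [/\ frame L, zero_dimensional L & algebraic L].

(* The property, for a partial order that is not given with an instance of
   [ctbDistrLatticeType], of being a complemented distributive bounded
   lattice. *)
Definition boolean_algebra L : Prop :=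
  [/\ forall x y : L,
        (supremums [set x; y] !=set0) /\ (infimums [set x; y] !=set0),
      (supremums (set0 : set L) !=set0) /\ (infimums (set0 : set L) !=set0),
      forall a b c j m : L, supremums [set b; c] j -> infimums [set a; j] m ->
        supremums (meets_with a [set b; c]) m
    & forall x : L, complemented x].

End OrderNotions.

Section Atomic.
Context {d : Order.disp_t}.
Implicit Type B : ctbDistrLatticeType d.

Definition atom B (a : B) : Prop :=
  a <> \bot /\ forall b : B, b <= a -> b = \bot \/ b = a.

Definition atomic B : Prop :=
  forall x : B, x <> \bot -> exists2 a : B, atom a & a <= x.

End Atomic.

Section NecessityOperators.
Context {d : Order.disp_t} (B : ctbDistrLatticeType d).

(* The empty sequence gives [f \top = \top]. *)
Definition preserves_finite_meets (f : B -> B) : Prop :=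
  forall s : seq B, f (\meet_(a <- s) a) = \meet_(a <- s) f a.

Record NO := NecessityOperator {
  NO_fun :> B -> B;
  _ : `[< preserves_finite_meets NO_fun >] }.

HB.instance Definition _ := [isSub for NO_fun].
HB.instance Definition _ := [Choice of NO by <:].
(* The order inherited from [B -> B], which is the pointwise one. *)
HB.instance Definition _ := [SubChoice_isSubPOrder of NO by <:
  with FunOrder.fun_display].

Lemma NO_leP (f g : NO) : (f <= g) <-> (forall a : B, f a <= g a).
Proof. by split => [/asboolP | /asboolP]. Qed.

End NecessityOperators.

(* Main.v *)
Require Import Defs.
From mathcomp Require Import all_boot all_order.
From mathcomp Require Import boolp classical_sets.
From mathcomp Require Import cardinality.

(** A necessity operator [f] amounts to the family of the filters
    [{b | x <= f b}], for [x] an atom.  Joins of operators are joins of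
    filters: [(\/ S) b] is the join of the [f_1 c_1 /\ ... /\ f_n c_n] with
    the [f_i] in [S] and [c_1 /\ ... /\ c_n <= b].  The operators whose
    filter at one atom [x] is principal, and whose filters at the other atoms are [{\top}], are
    compact (as [x] lies below a join iff it lies below one of its terms) and
    complemented, and each operator is the join of those below it.  In
    [NO (set nat)], let [f] be the operator with the cofinite filter at each
    atom, and [g n] the one with the filter generated by [0, n[.  Then
    [f \/ g n] is the greatest operator for all [n], whereas the meet of the
    [g n] is the least one; and [f] is dense without being the greatest
    operator, so that it has no complement. *)

Set Implicit Arguments.
Unset Strict Implicit.
Unset Printing Implicit Defensive.

Import Order.Theory.

Local Open Scope classical_set_scope.
Local Open Scope order_scope.

(** * Joins and meets in a partial order *)

Section Lattices.
Context {d : Order.disp_t} {L : porderType d}.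
Implicit Types (S : set L) (x y z : L).

Lemma supremums_le S x y : supremums S x -> ubound S y -> x <= y.
Proof. by move=> [_]; apply. Qed.

Lemma infimums_ge S x y : infimums S x -> lbound S y -> y <= x.
Proof. by move=> [_]; apply. Qed.

Lemma infimums_le S x y : infimums S x -> S y -> x <= y.
Proof. by move=> [+ _]; apply. Qed.

Lemma supremums_ge S x y : supremums S x -> S y -> y <= x.
Proof. by move=> [+ _]; apply. Qed.

Lemma supremums_complete_lattice :
  (forall S, supremums S !=set0) -> complete_lattice L.
Proof.
move=> hsup S; split => //; have [m [ubm lbm]] := hsup (lbound S).
exists m; split=> [y Sy|y lby]; last exact: ubm.
by apply: lbm => z lbz; apply: lbz.
Qed.

End Lattices.

(** * Joins and atoms in a boolean algebra *)

Section BooleanJoins.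
Context {d : Order.disp_t} {B : ctbDistrLatticeType d}.
Implicit Types (S : set B) (a b x y : B).

Lemma leI_leUC x a b : (x `&` a <= b) = (a <= b `|` ~` x).
Proof.
apply/idP/idP => [h|h].
  by rewrite -[a](@meet1x _ B) -(joinxC x) meetUl leU2 // leIl.
by rewrite (le_trans (leI2 (lexx x) h)) // meetUr meetxC joinx0 leIr.
Qed.

(** By the residuation [leI_leUC], the hypothesis says that one fixed element bounds [S] from
    above. *)
Lemma meet_supremums_le {S x s u} : supremums S s ->
  (forall y, S y -> x `&` y <= u) -> x `&` s <= u.
Proof.
move=> hs hu; rewrite leI_leUC; apply: (supremums_le hs) => y /hu.
by rewrite leI_leUC.
Qed.

Lemma atom_leVmeet a x : atom a -> a <= x \/ a `&` x = \bot.
Proof. by move=> [_ /(_ (a `&` x) (leIl _ _))[|/meet_idPl]]; [right|left]. Qed.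

(** An atom below no member of [S] is disjoint from each of them, hence from [s]; being below [s],
    it would be [\bot]. *)
Lemma atom_le_supremums a S s : atom a -> supremums S s -> a <= s ->
  exists2 y, S y & a <= y.
Proof.
move=> aa hs as_; apply: contrapT => noy; case: aa.1; apply/eqP.
rewrite -lex0 -(meet_l as_); apply: (meet_supremums_le hs) => y Sy.
by have [ay|->//] := atom_leVmeet y aa; case: noy; exists y.
Qed.

(** Otherwise [x] minus [y] is nonzero, and an atom below it lies below both [y] and its
    complement. *)
Lemma atomic_leP : atomic B -> forall x y,
  (forall a, atom a -> a <= x -> a <= y) -> x <= y.
Proof.
move=> atB x y h; rewrite -[y]complK -disj_leC; apply/eqP.
apply: contrapT => /atB[a aa]; rewrite lexI => /andP[/(h _ aa) ay ayC].
by apply: aa.1; apply/eqP; rewrite -lex0 -(meetxC y) lexI ay.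
Qed.

End BooleanJoins.

Section Operators.
Context {d : Order.disp_t} {B : ctbDistrLatticeType d}.
Implicit Types (f g h : NO B) (a b x : B) (P Q : pred B).

Lemma NO_meets f (I : Type) (s : seq I) (F : I -> B) :
  f (\meet_(i <- s) F i) = \meet_(i <- s) f (F i).
Proof.
by have /asboolP/(_ [seq F i | i <- s]) := valP f; rewrite !big_map.
Qed.

Lemma NO_top f : f \top = \top.
Proof. by have := NO_meets f [::] id; rewrite !big_nil. Qed.

Lemma NO_meet f a b : f (a `&` b) = f a `&` f b.
Proof.
by have := NO_meets f [:: a; b] id; rewrite !big_cons !big_nil !meetx1.
Qed.

Lemma NO_mono f a b : a <= b -> f a <= f b.
Proof. by move=> /meet_l <-; rewrite NO_meet leIr. Qed.

Lemma preserves_finite_meetsP (f : B -> B) :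
  f \top = \top -> {morph f : a b / a `&` b} -> preserves_finite_meets f.
Proof. by move=> f1 fI s; elim/big_rec2: _ => // a _ b _ <-. Qed.

Lemma NO_of (f : B -> B) : f \top = \top -> {morph f : a b / a `&` b} ->
  {g : NO B | g =1 f}.
Proof.
move=> f1 fI.
by exists (NecessityOperator (asboolT (preserves_finite_meetsP f1 fI))).
Qed.

Lemma NO_meet_subproof f g : {h : NO B | h =1 fun a => f a `&` g a}.
Proof.
apply: NO_of => [|a b]; first by rewrite !NO_top meetxx.
by rewrite !NO_meet meetACA.
Qed.

Definition meetNO f g : NO B := sval (NO_meet_subproof f g).

Lemma meetNOE f g a : meetNO f g a = f a `&` g a.
Proof. exact: (svalP (NO_meet_subproof f g)). Qed.

Lemma infimums2_meetNO f g h : infimums [set f; g] h -> h = meetNO f g.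
Proof.
move=> hh; apply/le_anti/andP; split.
  apply/NO_leP => a; rewrite meetNOE lexI.
  by apply/andP; split; move: a; apply/NO_leP/(infimums_le hh); [left|right].
apply: (infimums_ge hh) => _ [->|->]; apply/NO_leP => a; rewrite meetNOE.
  exact: leIl.
exact: leIr.
Qed.

Lemma meetNO_infimums f g : infimums [set f; g] (meetNO f g).
Proof.
split=> [_ [->|->]|h hh]; apply/NO_leP => a; rewrite meetNOE ?leIl ?leIr //.
by rewrite lexI; apply/andP; split; move: a; apply/NO_leP/hh; [left|right].
Qed.

(** * Operators built from filters *)

Definition is_filter P : Prop :=
  P \top /\ forall a b, P (a `&` b) = P a && P b.

Lemma filter_ge a : is_filter (>= a).
Proof. by split=> [|b c] /=; rewrite ?lex1 ?lexI. Qed.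

(* At the atoms below [x] the filter is [Q], at the other ones it is [P]. *)
Lemma NO_step_subproof P Q x : is_filter P -> is_filter Q -> subpred P Q ->
  {h : NO B | h =1 fun a => if P a then \top else if Q a then x else \bot}.
Proof.
move=> [P1 PI] [_ QI] PQ; apply: NO_of => [|a b]; first by rewrite P1.
rewrite PI QI; have := PQ a; have := PQ b; case: (P a); case: (P b) => /=.
- by rewrite meetxx.
- by move=> _ ->//=; rewrite meet1x.
- by move=> -> //; rewrite andbT meetx1.
- by move=> _ _; case: (Q a); case: (Q b); rewrite /= ?meetxx ?meetx0 ?meet0x.
Qed.

Definition stepNO a b x (ab : b <= a) : NO B :=
  sval (NO_step_subproof x (filter_ge a) (filter_ge b)
          (fun c => le_trans ab)).

Lemma stepNOE a b x (ab : b <= a) c :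
  stepNO x ab c = if a <= c then \top else if b <= c then x else \bot.
Proof. exact: (svalP (NO_step_subproof _ _ _ _)). Qed.

(** With two equal filters the middle case never occurs, so the value [\top] given for it is
    arbitrary. *)
Definition constNO P (FP : is_filter P) : NO B :=
  sval (NO_step_subproof \top FP FP (fun=> id)).

Lemma constNOE P (FP : is_filter P) a :
  constNO FP a = if P a then \top else \bot.
Proof.
by rewrite /constNO (svalP (NO_step_subproof _ _ _ _)); case: (P a).
Qed.

Definition bottomNO : NO B := constNO (filter_ge \top).
Definition topNO : NO B := constNO (filter_ge \bot).

Lemma topNOE a : topNO a = \top.
Proof. by rewrite constNOE le0x. Qed.

Lemma bottomNO_le f : bottomNO <= f.
Proof.
apply/NO_leP => a; rewrite constNOE le1x; case: eqP => [->|_]; last exact: le0x.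
by rewrite NO_top.
Qed.

Lemma le_topNO f : f <= topNO.
Proof. by apply/NO_leP => a; rewrite topNOE lex1. Qed.

Lemma supremums_bottomNO : supremums set0 bottomNO.
Proof. by split=> // f _; exact: bottomNO_le. Qed.

Lemma infimums_topNO : infimums set0 topNO.
Proof. by split=> // f _; exact: le_topNO. Qed.

Definition atomNO a x : NO B := stepNO x (lex1 a).
(** The future complement of [atomNO a x]: at atoms below [x] the filter is generated by the
    complement of [a], at the others it is improper. *)
Definition coatomNO a x : NO B := stepNO (~` x) (le0x (~` a)).

Lemma atomNO_le a x f : (atomNO a x <= f) = (x <= f a).
Proof.
apply/idP/idP => [/NO_leP/(_ a)|xfa].
  by rewrite stepNOE le1x lexx; case: eqP => // -> _; rewrite NO_top lex1.
apply/NO_leP => b; rewrite stepNOE le1x; case: eqP => [->|_].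
  by rewrite NO_top.
by case: ifP => [ab|_]; [exact: le_trans xfa (NO_mono f ab)|exact: le0x].
Qed.

Lemma complemented_atomNO a x : complemented (atomNO a x).
Proof.
exists (coatomNO a x); split.
  exists bottomNO; split; last exact: supremums_bottomNO.
  suff -> : bottomNO = meetNO (atomNO a x) (coatomNO a x).
    exact: meetNO_infimums.
  apply/le_anti; rewrite bottomNO_le /=; apply/NO_leP => b.
  rewrite meetNOE constNOE !stepNOE le1x le0x.
  case: (b =P \top) => [->|b1]; first exact: lex1.
  case: ifP => ab; last by rewrite meet0x.
  case: ifP => ab'; last by rewrite meetxC.
  by case: b1; apply/eqP; rewrite -le1x -(joinxC a) leUx ab.
exists topNO; split; last exact: infimums_topNO.
split=> [? _|h hh]; first exact: le_topNO.
have /NO_leP h1 : atomNO a x <= h by apply: hh; left.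
have /NO_leP h2 : coatomNO a x <= h by apply: hh; right.
(* Write [b] as the meet of its joins with [a] and with the complement of [a]. At the first, [h]
   lies above [x] and its complement; at the second, [coatomNO a x] is already [\top]. *)
apply/NO_leP => b; rewrite topNOE -[b](@joinx0 _ B) -(meetxC a) joinIr NO_meet.
rewrite lexI; apply/andP; split.
  rewrite -(joinxC x) leUx; apply/andP; split.
    by apply: (le_trans _ (NO_mono h (leUr a b)));
      rewrite -atomNO_le; apply/NO_leP.
  by apply: (le_trans _ (h2 _)); rewrite stepNOE le0x; case: ifP; rewrite ?lex1.
by apply: (le_trans _ (h2 _)); rewrite stepNOE leUr.
Qed.

(** * Joins of operators, the frame law and compactness *)

Section Complete.
Hypothesis cB : complete_lattice B.

Definition join_terms (S : set (NO B)) b : set B :=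
  [set \meet_(p <- s) p.1 p.2 | s in
    [set s : seq (NO B * B) |
      (forall p, p \in s -> S p.1) /\ \meet_(p <- s) p.2 <= b]].

Lemma NO_supremums (S : set (NO B)) :
  exists2 j : NO B, forall b, supremums (join_terms S b) (j b) & supremums S j.
Proof.
have [J HJ] := choice (fun b => (cB (join_terms S b)).1).
have J_mono a b : a <= b -> J a <= J b.
  move=> ab; apply: (supremums_le (HJ a)) => _ [s [Ss sa] <-].
  by apply: (supremums_ge (HJ b)); exists s; split=> //; exact: le_trans ab.
have [||j jE] := @NO_of J.
- apply/eqP; rewrite -le1x; apply: (supremums_ge (HJ _)).
  by exists [::]; [split=> //; exact: lex1|rewrite big_nil].
- move=> a b; apply/le_anti; rewrite lexI !J_mono ?leIl ?leIr //=.
  apply: (meet_supremums_le (HJ b)) => _ [t [St tb] <-]; rewrite meetC.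
  apply: (meet_supremums_le (HJ a)) => _ [s [Ss sa] <-]; rewrite meetC.
  (* Concatenation turns a term for [a] and a term for [b] into a term for their meet. *)
  apply: (supremums_ge (HJ _)); exists (s ++ t); last by rewrite big_cat.
  split=> [p|]; first by rewrite mem_cat => /orP[/Ss|/St].
  by rewrite big_cat /= leI2.
exists j; first by move=> b; rewrite jE.
split=> [f Sf|g gS]; apply/NO_leP => b; rewrite jE.
  apply: (supremums_ge (HJ _)); exists [:: (f, b)]; rewrite ?big_seq1 //.
  by split=> [p|]; rewrite ?inE ?big_seq1 // => /eqP->.
apply: (supremums_le (HJ b)) => _ [s [Ss sb] <-].
apply: (le_trans _ (NO_mono g sb)); rewrite NO_meets.
apply/meetsP_seq => p ps _; apply: le_trans (meets_inf_seq _ ps _) _ => //.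
by move: p.2; apply/NO_leP/gS/Ss.
Qed.

Lemma supremums_NOE (S : set (NO B)) f b : supremums S f ->
  supremums (join_terms S b) (f b).
Proof.
have [j jE jS] := NO_supremums S.
by move=> /is_subset1_supremums/(_ jS)->.
Qed.

Lemma frame_NO : frame (NO B).
Proof.
split=> [|f S s m hs /infimums2_meetNO ->].
  by apply: supremums_complete_lattice => S;
    have [j _ jS] := NO_supremums S; exists j.
split=> [_ [g Sg /infimums2_meetNO ->]|u hu];
  apply/NO_leP => b; rewrite !meetNOE.
  by rewrite leI2 //; move: b; apply/NO_leP/(supremums_ge hs).
apply: (meet_supremums_le (supremums_NOE b hs)) => _ [t [St tb] <-].
(* The meet of the [p.2] is below [b], so joining each with [b] makes their meet exactly [b]. Then
   [f b] lies below [f] at each of these joins, and [u] can be compared with [meetNO f p.1]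
   there. *)
have -> : u b = \meet_(p <- t) u (b `|` p.2).
  by rewrite -NO_meets -(big_morph _ (joinIr b) (joinx1 b)) (join_l tb).
apply/meetsP_seq => p pt _.
have /NO_leP/(_ (b `|` p.2)) : meetNO f p.1 <= u.
  by apply: hu; exists p.1; [exact: St|exact: meetNO_infimums].
rewrite meetNOE; apply: le_trans; rewrite leI2 ?NO_mono ?leUl //.
by rewrite (le_trans (meets_inf_seq _ pt _)) // NO_mono // leUr.
Qed.

(** The atom [x] lies below a single term of the join, and the finitely many operators occurring in
    that term suffice. *)
Lemma compact_atomNO a x : atom x -> compact_element (atomNO a x).
Proof.
move=> ax S s hs; rewrite atomNO_le.
move=> /(atom_le_supremums ax (supremums_NOE a hs))[_ [t [St ta] <-] xt].
have [j jE jS] := NO_supremums [set` [seq p.1 | p <- t]].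
exists [set` [seq p.1 | p <- t]], j; split=> //; first exact: finite_seq.
- by move=> _ /= /mapP[p pt ->]; exact: St.
- rewrite atomNO_le; apply: le_trans xt _; apply: (supremums_ge (jE a)).
  by exists t; split=> // p pt; exact: map_f.
Qed.

End Complete.

Lemma supremums_atomNO f : atomic B ->
  supremums [set g | exists a x, [/\ atom x, x <= f a & g = atomNO a x]] f.
Proof.
move=> atB; split=> [_ [a [x [_ xfa ->]]]|g hg]; first by rewrite atomNO_le.
apply/NO_leP => a; apply: (atomic_leP atB) => x ax xfa.
by rewrite -atomNO_le; apply: hg; exists a, x.
Qed.

Lemma locally_stone_NO : complete_lattice B -> atomic B ->
  locally_stone_frame (NO B).
Proof.
move=> cB atB; split=> [|f|f]; first exact: frame_NO.
- eexists; last exact: supremums_atomNO.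
  by move=> _ [a [x [_ _ ->]]]; exact: complemented_atomNO.
- eexists; last exact: supremums_atomNO.
  by move=> _ [a [x [ax _ ->]]]; exact: compact_atomNO.
Qed.

End Operators.

(** * Counterexamples over the powerset of the natural numbers *)

Lemma filter_cofinite : is_filter (fun A : set nat => `[< cofinite_set A >]).
Proof.
split=> [|A C]; first by apply/asboolP; exact: cofinite_setT.
by rewrite -asbool_and meetEset cofinite_setI.
Qed.

Definition cofiniteNO : NO (set nat) := constNO filter_cofinite.

Definition initialNO (n : nat) : NO (set nat) := constNO (filter_ge `I_n).

Lemma topNO_nle_cofiniteNO : ~ topNO <= cofiniteNO.
Proof.
move=> /NO_leP/(_ \bot); rewrite topNOE constNOE asboolF ?le1x.
  by move=> /eqP /seteqP[_ /(_ 0 I)].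
by rewrite botEset setC0; exact: infinite_nat.
Qed.

(** Such an [h] is [\top] both at [I_n] and at its cofinite complement, hence at their meet [\bot],
    hence everywhere. *)
Lemma topNO_cofinite_initial n h :
  cofiniteNO <= h -> initialNO n <= h -> topNO <= h.
Proof.
move=> /NO_leP/(_ (~` `I_n)) h1 /NO_leP/(_ `I_n) h2.
apply/NO_leP => A; apply: (le_trans _ (NO_mono h (le0x A))).
rewrite topNOE -(meetxC (`I_n : set nat)) NO_meet lexI.
move: h1 h2; rewrite !constNOE lexx => + -> /=; rewrite asboolT //.
by rewrite complEset setCK; exact: finite_II.
Qed.

Lemma neq_topset (T : Type) (A : set T) : A <> \top -> exists x, ~ A x.
Proof.
move=> A1; apply: contrapT => nA; apply: A1; apply/seteqP; split=> // x _.
by apply: contrapT => Ax; apply: nA; exists x.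
Qed.

Lemma initialNO_bottom h : (forall n, h <= initialNO n) -> h <= bottomNO.
Proof.
move=> hn; apply/NO_leP => A; rewrite constNOE le1x.
case: (A =P \top) => [_|A1]; first exact: lex1.
have [n An] := neq_topset A1.
(* The successor is taken because [I_n] stops before [n], the point missing from [A]. *)
have /NO_leP/(_ A) := hn n.+1; rewrite constNOE; case: ifP => //.
by move=> /subsetPset/(_ n (ltnSn n)).
Qed.

(** The dual law would make [cofiniteNO] the meet of its joins with the [initialNO n], all of which
    are [topNO]. *)
Lemma not_coframe_NO : ~ coframe (NO (set nat)).
Proof.
move=> [_ H]; have inf : infimums (range initialNO) bottomNO.
  split=> [f _|h hh]; first exact: bottomNO_le.
  by apply: initialNO_bottom => n; apply: hh; exists n.
have sup : supremums [set cofiniteNO; bottomNO] cofiniteNO.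
  split=> [_ [->|->]//|h hh]; first exact: bottomNO_le.
  by apply: hh; left.
apply: topNO_nle_cofiniteNO.
apply: (infimums_ge (H _ _ _ _ inf sup)) => c [_ [n _ <-] hc].
by apply: (@topNO_cofinite_initial n); apply: (supremums_ge hc); [left|right].
Qed.

Lemma not_completely_distributive_NO : ~ completely_distributive (NO (set nat)).
Proof.
move=> [_ H]; apply: topNO_nle_cofiniteNO.
pose x n b := if b then cofiniteNO else initialNO n.
have sup n : supremums (range (x n)) topNO.
  split=> [f _|h hh]; first exact: le_topNO.
  by apply: (@topNO_cofinite_initial n); apply: hh; [exists true|exists false].
have inf : infimums (range (fun _ : nat => @topNO _ (set nat))) topNO.
  by split=> [_ [_ _ <-]//|h hh]; exact: le_topNO.
apply: (supremums_le (H nat (fun=> bool) _ _ _ sup inf)) => c [phi hc].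
(* A choice function that ever picks [cofiniteNO] has its meet below it; one that never does meets
   all the [initialNO n], which gives [bottomNO]. *)
have [[n phin]|nphi] := pselect (exists n, phi n).
  by apply: (infimums_le hc); exists n; rewrite /x ?phin.
apply: (le_trans _ (bottomNO_le _)); apply: initialNO_bottom => n.
apply: (infimums_le hc); exists n => //; rewrite /x; case: ifP => // phin.
by case: nphi; exists n.
Qed.

(** A set missing [n] lies in the complement of [[set n]], where [cofiniteNO] is [\top] and so [f]
    must be [\bot]. *)
Lemma cofiniteNO_dense (f : NO (set nat)) :
  meetNO cofiniteNO f <= bottomNO -> f <= bottomNO.
Proof.
move=> /NO_leP fb; apply/NO_leP => A; rewrite constNOE le1x.
case: (A =P \top) => [_|A1]; first exact: lex1.
have [n An] := neq_topset A1.
have AC : A <= ~` [set n].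
  by apply/subsetPset => k Ak; rewrite complEset => kn; apply: An; rewrite -kn.
apply: le_trans (NO_mono f AC) _; have := fb (~` [set n]).
rewrite meetNOE !constNOE asboolT ?meet1x; last first.
  by rewrite complEset setCK; exact: finite_set1.
rewrite le1x; case: eqP => // /seteqP[_ /(_ n I)]; by case.
Qed.

Lemma not_boolean_algebra_NO : ~ boolean_algebra (NO (set nat)).
Proof.
move=> [_ _ _ /(_ cofiniteNO)[f [[z [hz z0]] [t [ht t1]]]]].
apply: topNO_nle_cofiniteNO.
apply: le_trans (infimums_ge t1 _) _ => //.
apply: (supremums_le ht) => _ [->|->]//.
apply: (le_trans _ (bottomNO_le _)); apply: cofiniteNO_dense.
by rewrite -(infimums2_meetNO hz); apply: (supremums_le z0).
Qed.

Theorem corollary3p16 :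
  (forall (d : Order.disp_t) (B : ctbDistrLatticeType d),
     complete_lattice B -> atomic B -> locally_stone_frame (NO B)) /\
  [/\ ~ coframe (NO (set nat)),
      ~ completely_distributive (NO (set nat))
    & ~ boolean_algebra (NO (set nat))].
Proof.
split; first by move=> d B; exact: locally_stone_NO.
split.
- exact: not_coframe_NO.
- exact: not_completely_distributive_NO.
- exact: not_boolean_algebra_NO.
Qed.
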